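(* Let $j$ be any positive integer and let $\mathbf{I}\mathbb{N}_{\infty}^{\boldsymbol{g}[j]}$ be a proper dense subsemigroup of a Hausdorff topological inverse semigroup $S$. Then $I=S\setminus \mathbf{I}\mathbb{N}_{\infty}^{\boldsymbol{g}[j]}$, with the operation and the topology induced from $S$, is a topological group.
   Context: $\mathbb{N}$ is the set of positive integers with the metric $|n-m|$ and $[n)=\{m\in\mathbb{N}\colon m\geqslant n\}$. Partial maps are written on the right and composed left to right: $x(\gamma\delta)=(x\gamma)\delta$, with $\operatorname{dom}(\gamma\delta)=\{x\in\operatorname{dom}\gamma\colon x\gamma\in\operatorname{dom}\delta\}$. $\mathbf{I}\mathbb{N}_{\infty}$ is the inverse monoid (under composition) of all partial isometries $\gamma\colon\mathbb{N}\rightharpoonup\mathbb{N}$ (i.e. $|x\gamma-y\gamma|=|x-y|$ for all $x,y\in\operatorname{dom}\gamma$) which are cofinite, i.e. $\mathbb{N}\setminus\operatorname{dom}\gamma$ and $\mathbb{N}\setminus\operatorname{ran}\gamma$ are finite. $\mathscr{C}_{\mathbb{N}}$ is its submonoid generated by $\alpha\colon n\mapsto n+1$ ($\operatorname{dom}\alpha=\mathbb{N}$) and $\beta\colon n\mapsto n-1$ ($\operatorname{dom}\beta=\mathbb{N}\setminus\{1\}$); it is isomorphic to the bicyclic monoid. For $\gamma\in\mathbf{I}\mathbb{N}_{\infty}$, $\underline{n}_{\gamma}^{\mathbf{d}}=\min\operatorname{dom}\gamma$, and $n_{\gamma}^{\mathbf{d}}$ is the smallest $n\in\operatorname{dom}\gamma$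 such that the restriction $\gamma|_{[n)}$ belongs to $\mathscr{C}_{\mathbb{N}}$ (i.e. $[n)\subseteq\operatorname{dom}\gamma$ and $\gamma$ is a shift on $[n)$). For a non-negative integer $j$, $\mathbf{I}\mathbb{N}_{\infty}^{\boldsymbol{g}[j]}=\{\gamma\in\mathbf{I}\mathbb{N}_{\infty}\colon n_{\gamma}^{\mathbf{d}}-\underline{n}_{\gamma}^{\mathbf{d}}\leqslant j\}$, which is an inverse submonoid of $\mathbf{I}\mathbb{N}_{\infty}$. A topological inverse semigroup is an inverse semigroup with a topology for which the semigroup operation is (jointly) continuous and the inversion $x\mapsto x^{-1}$ is continuous. *)

(* Defs.v *)
From HB Require Import structures.
From mathcomp Require Import all_boot all_order all_algebra.
From mathcomp Require Import zify.
From mathcomp Require Import all_classical all_reals all_analysis.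
Set Implicit Arguments.
Unset Strict Implicit.
Unset Printing Implicit Defensive.

Local Open Scope classical_set_scope.
Local Open Scope group_scope.
Local Open Scope nat_scope.

Record posn := Posn { nat_of_posn :> nat; _ : 0 < nat_of_posn }.
HB.instance Definition _ := [isSub for nat_of_posn].
HB.instance Definition _ := [Countable of posn by <:].

Lemma posn_gt0 (n : posn) : 0 < n. Proof. by case: n. Qed.

Definition posn1 : posn := @Posn 1 isT.

Definition posnD (n : posn) (k : nat) : posn :=
  @Posn (n + k) (ltn_addr k (posn_gt0 n)).

(* A partial map is total into [option]; [None] means undefined. *)
Record pmap := Pmap { pmap_fun :> posn -> option posn }.
HB.instance Definition _ := gen_eqMixin pmap.
HB.instance Definition _ := gen_choiceMixin pmap.

Lemma pmap_ext (f g : pmap) : f =1 g -> f = g.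
Proof. by case: f g => f [g] /= /funext->. Qed.

(* Maps act on the right: [g * d] applies [g] first. *)
Definition pcomp (g d : pmap) : pmap := Pmap (fun x => obind d (g x)).

Lemma pcompA : associative pcomp.
Proof.
by move=> f g h; apply: pmap_ext => x /=; case: (f x).
Qed.

Lemma pcomp1 : left_id (Pmap Some) pcomp.
Proof. by move=> f; apply: pmap_ext. Qed.

Lemma pcompr1 : right_id (Pmap Some) pcomp.
Proof. by move=> f; apply: pmap_ext => x /=; case: (f x). Qed.

HB.instance Definition _ := isMonoid.Build pmap pcompA pcomp1 pcompr1.

Definition pdom (g : pmap) : set posn := [set x | exists y, g x = Some y].
Definition pran (g : pmap) : set posn := [set y | exists x, g x = Some y].

Definition prestr (g : pmap) (n : posn) : pmap :=
  Pmap (fun x => if n <= x then g x else None).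

Definition partial_isometry (g : pmap) : Prop :=
  forall x y x' y' : posn, g x = Some x' -> g y = Some y' ->
    (`|x'%:Z - y'%:Z| = `|x%:Z - y%:Z|)%R.

Definition IN_infty : set pmap :=
  [set g | [/\ partial_isometry g,
               finite_set (~` pdom g) & finite_set (~` pran g)]].

Definition palpha : pmap := Pmap (fun n => Some (posnD n 1)).

(* [insub n.-1] is [None] exactly when [n = 1]. *)
Definition pbeta : pmap := Pmap (fun n => insub n.-1).

Definition submonoid (M : set pmap) : Prop :=
  M 1%g /\ forall g d, M g -> M d -> M (g * d)%g.

Definition C_N : set pmap := smallest submonoid [set palpha; pbeta].

(* Only meaningful for nonempty [A]; both uses below are on nonempty sets. *)
Definition least (A : set posn) : posn :=
  xget posn1 [set n | A n /\ forall m : posn, A m -> n <= m].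

Definition ndom_min (g : pmap) : posn := least (pdom g).

Definition ndom_shift (g : pmap) : posn :=
  least [set n | pdom g n /\ C_N (prestr g n)].

Definition IN_g (j : nat) : set pmap :=
  [set g | IN_infty g /\ ndom_shift g - ndom_min g <= j].

Lemma least_spec (A : set posn) : A !=set0 ->
  A (least A) /\ forall m : posn, A m -> least A <= m.
Proof.
move=> [a Aa]; rewrite /least; case: xgetP => [x _ [] //|nP].
suff [n Pn] : exists n : posn, A n /\ forall m : posn, A m -> n <= m.
  by have := nP n Pn.
have ex : exists n : nat, `[< exists2 b : posn, A b & b = n :> nat >].
  by exists a; apply/asboolP; exists a.
case: (ex_minnP ex) => n /asboolP[b Ab bn] nmin.
exists b; split => // m Am; rewrite bn; apply: nmin.
by apply/asboolP; exists m.
Qed.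

Lemma finite_posn_bound (A : set posn) : finite_set A ->
  exists N : nat, forall x : posn, A x -> x < N.
Proof.
move=> /finite_seqP[s ->]; exists (\max_(x <- s) (nat_of_posn x)).+1 => x /= xs.
by rewrite ltnS; apply: leq_bigmax_seq.
Qed.

Lemma cofinite_dom (g : pmap) : finite_set (~` pdom g) ->
  exists N : posn, forall x : posn, N <= x -> pdom g x.
Proof.
move=> /finite_posn_bound[N hN].
exists (@Posn N.+1 isT) => x /= Nx; apply: contrapT => /hN; lia.
Qed.

Lemma IN_infty_shift (g : pmap) : IN_infty g ->
  exists c : int, forall x y : posn, g x = Some y -> (y%:Z = x%:Z + c)%R.
Proof.
move=> [iso /cofinite_dom[N hN] _].
have [a ga] := hN N (leqnn N).
exists (a%:Z - N%:Z)%R => x y gx.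
have [b gb] := hN (posnD N (x + y + a)) (leq_addr _ _).
have := iso _ _ _ _ gb ga; have := iso _ _ _ _ gb gx.
have := posn_gt0 b; rewrite /=; lia.
Qed.

Lemma C_N_up (k : pmap) : C_N k -> forall (x y : posn), k x = Some y ->
  forall n, k (posnD x n) = Some (posnD y n).
Proof.
move=> /(_ [set k : pmap | forall (x y : posn), k x = Some y ->
  forall n, k (posnD x n) = Some (posnD y n)]); apply; split; last first.
  move=> _ [->|->] x y.
    move=> [<-] n; congr Some; apply: val_inj => /=; lia.
  rewrite /pbeta /=; case: insubP => //= u _ ux [<-] n.
  have u0 := posn_gt0 u.
  rewrite insubT /=; first by lia.
  by move=> p; congr Some; apply: val_inj => /=; lia.
split=> [x y [->] //|f h fP hP x y].
have E u : (f * h)%g u = obind h (f u) by [].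
rewrite !E; case fx : (f x) => [z|] //= hz n.
by rewrite (fP _ _ fx) /=; exact: hP.
Qed.

Lemma pbetaX n (x : posn) : (pbeta ^+ n)%g x = insub (x - n).
Proof.
elim: n x => [|n IH] x.
  by rewrite subn0 insubT ?posn_gt0 // => p; congr Some; apply: val_inj.
rewrite expgS; have -> : (pbeta * pbeta ^+ n)%g x = obind (pbeta ^+ n)%g (pbeta x).
  by [].
rewrite /pbeta /=; case: insubP => [u _ ux|] /=.
  by rewrite IH; congr insub; have := posn_gt0 u; rewrite /= in ux; lia.
by move=> x1; rewrite insubN //; lia.
Qed.

Lemma palphaX n (x : posn) : (palpha ^+ n)%g x = Some (posnD x n).
Proof.
elim: n x => [|n IH] x.
  by congr Some; apply: val_inj => /=; lia.
rewrite expgS; have -> : (palpha * palpha ^+ n)%g x = (palpha ^+ n)%g (posnD x 1).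
  by [].
by rewrite IH; congr Some; apply: val_inj => /=; lia.
Qed.

Lemma C_N_submonoid : submonoid C_N.
Proof.
split; first by move=> M [[]].
by move=> g d Cg Cd M MM; case: (MM) => -[_ +] _; apply; [exact: Cg|exact: Cd].
Qed.

Lemma C_N_X g n : C_N g -> C_N (g ^+ n)%g.
Proof.
move=> Cg; elim: n => [|n IH]; first exact: C_N_submonoid.1.
by rewrite expgS; apply: C_N_submonoid.2.
Qed.

Lemma C_N_restr (g : pmap) (n : posn) : IN_infty g ->
  (forall x : posn, n <= x -> pdom g x) -> C_N (prestr g n).
Proof.
move=> /IN_infty_shift[c gc] nd.
have [m gn] := nd n (leqnn n).
have n0 := posn_gt0 n; have m0 := posn_gt0 m.
suff -> : prestr g n = (pbeta ^+ n.-1 * palpha ^+ m.-1)%g.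
  by apply: C_N_submonoid.2; apply: C_N_X => M [_]; apply; [right|left].
apply: pmap_ext => x.
have -> : (pbeta ^+ n.-1 * palpha ^+ m.-1)%g x =
  obind (palpha ^+ m.-1)%g ((pbeta ^+ n.-1)%g x) by [].
rewrite pbetaX /prestr /=; case: ifPn => nx; last by rewrite insubN //; lia.
have [y gx] := nd x nx; rewrite gx insubT /=; first by lia.
move=> p; rewrite palphaX; congr Some; apply: val_inj => /=.
have := gc _ _ gx; have := gc _ _ gn; lia.
Qed.

Lemma C_N_restr_dom (g : pmap) (n : posn) : pdom g n -> C_N (prestr g n) ->
  forall x : posn, n <= x -> pdom g x.
Proof.
move=> [m gn] /C_N_up/(_ n m); rewrite {1}/prestr /= leqnn => /(_ gn) up x nx.
exists (posnD m (x - n)); have := up (x - n).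
rewrite /prestr /= leq_addr.
by have -> : posnD n (x - n) = x by apply: val_inj => /=; lia.
Qed.

Lemma ndom_minP (g : pmap) : IN_infty g ->
  pdom g (ndom_min g) /\ forall m : posn, pdom g m -> ndom_min g <= m.
Proof. by move=> [_ /cofinite_dom[N hN] _]; apply: least_spec; exists N; apply: hN. Qed.

Lemma ndom_shiftP (g : pmap) : IN_infty g ->
  (forall x : posn, ndom_shift g <= x -> pdom g x) /\
  forall n : posn, (forall x : posn, n <= x -> pdom g x) -> ndom_shift g <= n.
Proof.
move=> gI; have [_ /cofinite_dom[N hN] _] := gI.
have [|[d C] m] := @least_spec [set n | pdom g n /\ C_N (prestr g n)].
  by exists N; split; [exact: hN|exact: C_N_restr].
split=> [|n nd]; first exact: C_N_restr_dom.
by apply: m; split; [exact: nd|exact: C_N_restr].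
Qed.

Lemma pcomp_domP (g d : pmap) x : pdom (g * d)%g x <->
  exists2 y, g x = Some y & pdom d y.
Proof.
have E : (g * d)%g x = obind d (g x) by [].
rewrite /pdom /mkset E; case: (g x) => [y|] /=; last by split=> [[]|[]].
by split=> [|[z [<-]]] //; exists y.
Qed.

Lemma cofinite_posn (A : set posn) (N : nat) :
  (forall x : posn, N <= x -> A x) -> finite_set (~` A).
Proof.
move=> h; apply: (@sub_finite_set _ _ (@nat_of_posn @^-1` `I_N)).
  by move=> x /= nA; rewrite ltnNge; apply/negP => /h.
apply: finite_preimage; last exact: finite_II.
by move=> x y _ _; apply: val_inj.
Qed.

Lemma IN_infty_mul (g d : pmap) : IN_infty g -> IN_infty d -> IN_infty (g * d)%g.
Proof.
move=> gI dI; have [c gc] := IN_infty_shift gI; have [c' dc] := IN_infty_shift dI.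
have [gi /finite_posn_bound[N1 g1] /finite_posn_bound[N2 g2]] := gI.
have [di /finite_posn_bound[N3 d1] /finite_posn_bound[N4 d2]] := dI.
have E x : (g * d)%g x = obind d (g x) by [].
split.
- move=> x y x' y'; rewrite !E.
  case gx : (g x) => [u|] //=; case gy : (g y) => [v|] //= du dv.
  by rewrite (di _ _ _ _ du dv) (gi _ _ _ _ gx gy).
- apply: (@cofinite_posn _ (N1 + N3 + `|c|%N)) => x hx.
  have [y gx] : pdom g x by apply: contrapT => /g1; lia.
  apply/pcomp_domP; exists y => //.
  by apply: contrapT => /d1; have := gc _ _ gx; lia.
- apply: (@cofinite_posn _ (N4 + N2 + `|c'|%N)) => z hz.
  have [y dy] : pran d z by apply: contrapT => /d2; lia.
  have [x gx] : pran g y by apply: contrapT => /g2; have := dc _ _ dy; lia.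
  by exists x; rewrite E gx.
Qed.

Lemma IN_g_mul j (g d : pmap) : IN_g j g -> IN_g j d -> IN_g j (g * d)%g.
Proof.
move=> [gI gj] [dI dj]; have gdI := IN_infty_mul gI dI; split=> //.
have [c gc] := IN_infty_shift gI.
have [_ mg] := ndom_minP gI; have [_ md] := ndom_minP dI.
have [/pcomp_domP[y gm dy] _] := ndom_minP gdI.
have ug := (ndom_shiftP gI).1; have ud := (ndom_shiftP dI).1.
have hg := mg _ (ex_intro _ _ gm); have hd := md _ dy; have cm := gc _ _ gm.
set m := ndom_min (g * d)%g in gm hg cm *.
have [_ /(_ (posnD m j))] := ndom_shiftP gdI.
rewrite /= => H; suff : ndom_shift (g * d)%g <= m + j by lia.
apply: H => x mx; have [z gx] : pdom g x by apply: ug; lia.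
apply/pcomp_domP; exists z => //; apply: ud; have := gc _ _ gx; lia.
Qed.

Definition IN_g_type (j : nat) := set_type (IN_g j).
HB.instance Definition _ j := Choice.on (IN_g_type j).

Definition IN_g_comp j (g d : IN_g_type j) : IN_g_type j :=
  SigSub (mem_set (IN_g_mul (set_valP g) (set_valP d))).

Lemma IN_g_compA j : associative (@IN_g_comp j).
Proof. by move=> f g h; apply: val_inj; rewrite /= mulgA. Qed.

HB.instance Definition _ j := isSemigroup.Build (IN_g_type j) (@IN_g_compA j).

HB.mixin Record Semigroup_isInverse S & Semigroup S := {
  sinv : S -> S;
  mul_sinvK : forall x : S, (x * sinv x * x)%g = x;
  sinv_mulK : forall x : S, (sinv x * x * sinv x)%g = sinv x;
  sinv_uniq : forall x y : S, (x * y * x)%g = x -> (y * x * y)%g = y -> y = sinv x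
}.

#[short(type="inverseSemigroupType")]
HB.structure Definition InverseSemigroup :=
  {S of Semigroup S & Semigroup_isInverse S}.

HB.mixin Record InverseSemigroup_isTopological S
    & Topological S & InverseSemigroup S := {
  smul_continuous : continuous (fun p : S * S => (p.1 * p.2)%g);
  sinv_continuous : continuous (sinv : S -> S)
}.

#[short(type="topologicalInverseSemigroupType")]
HB.structure Definition TopologicalInverseSemigroup :=
  {S of Topological S & InverseSemigroup S & InverseSemigroup_isTopological S}.

Definition topological_group_law (G : topologicalType) (op : G -> G -> G) : Prop :=
  exists (e : G) (inv : G -> G),
    [/\ associative op,
        left_id e op /\ right_id e op,
        left_inverse e inv op /\ right_inverse e inv op,
        continuous (fun p : G * G => op p.1 p.2) &
        continuous inv].

(* [A] is closed under the product of [S] and, with the restricted product and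
   the subspace topology carried by [set_type A], is a topological group. *)
Definition induces_topological_group (S : topologicalInverseSemigroupType)
    (A : set S) : Prop :=
  exists op : set_type A -> set_type A -> set_type A,
    (forall x y, set_val (op x y) = (set_val x * set_val y)%g) /\
    topological_group_law op.

(* Main.v *)
(** Write M for the image of the dense embedding. For fixed [u], [v] only
    finitely many elements of IN_g j send [u] to [v], so for [f] the identity of
    a large enough [[N)] the open set of [x] with [f x <> x] and [x f <> x] is a
    neighbourhood of a given point of M that meets M in a finite set; hence the
    points of M are isolated in S. Since [a x = m] and [x a = m] have finitely
    many solutions in M, the complement I of M is an ideal. As [x = x x^-1 x],
    both M and I are closed under inversion. Every idempotent of S is a limit of
    idempotents of M, and each idempotent of M fixes all but finitely many of
    the others, so idempotents of M act as identities on those of I. By density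
    idempotents of I also act trivially on each other, so I has only one
    idempotent and is a group. *)
Require Import Defs.
From mathcomp Require Import all_boot all_order all_algebra.
From mathcomp Require Import zify.
From mathcomp Require Import all_classical all_reals all_analysis.
Set Implicit Arguments.
Unset Strict Implicit.
Unset Printing Implicit Defensive.

Local Open Scope classical_set_scope.

(** * Open sets that meet a dense set in finitely many points *)

Lemma open_neq_continuous (T U : topologicalType) (f g : T -> U) :
  hausdorff_space U -> continuous f -> continuous g ->
  open [set x | f x <> g x].
Proof.
rewrite open_hausdorff => hU cf cg; rewrite openE => x /= /eqP /hU[[A B] /= [xA xB] [oA oB AB]].
have nA : nbhs x (f @^-1` A).
  by apply: cf; apply: open_nbhs_nbhs; split=> //; exact: set_mem.
have nB : nbhs x (g @^-1` B).
  by apply: cg; apply: open_nbhs_nbhs; split=> //; exact: set_mem.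
apply: filterS (filterI nA nB) => y /= [Ay By] fg.
by move/eqP/seteqP: AB => [AB0 _]; apply: (AB0 (f y)); split=> //; rewrite fg.
Qed.

Lemma open_setD_finite (T : topologicalType) (U F : set T) :
  accessible_space T -> open U -> finite_set F -> open (U `\` F).
Proof.
move=> T1 oU fF; rewrite setDE; apply: openI => //; apply: closed_openC.
exact: (accessible_finite_set_closed.1 T1).
Qed.

(** Deleting from [U] its finitely many points in [D] leaves an open set that misses [D], hence an
    empty one. *)
Lemma dense_open_finite_sub (T : topologicalType) (D U : set T) :
  accessible_space T -> dense D -> open U -> finite_set (U `&` D) -> U `<=` D.
Proof.
move=> T1 dD oU fUD x Ux; apply: contrapT => nDx.
have [||y [[Uy nUDy] Dy]] := dD (U `\` (U `&` D)).
- by exists x; split=> // -[].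
- exact: open_setD_finite.
- exact: nUDy.
Qed.

(** By the previous lemma [U] itself is finite, so its points other than [x] can be deleted. *)
Lemma dense_open_finite_set1 (T : topologicalType) (D U : set T) (x : T) :
  accessible_space T -> dense D -> open U -> finite_set (U `&` D) -> U x ->
  open [set x].
Proof.
move=> T1 dD oU fUD Ux; have UD := dense_open_finite_sub T1 dD oU fUD.
rewrite (_ : [set x] = U `\` (U `\ x)).
  apply: open_setD_finite => //; apply: sub_finite_set fUD => y [Uy _].
  by split=> //; exact: UD.
apply/seteqP; split=> [y ->|y [Uy nUy]]; first by split=> // -[_ /(_ erefl)].
by apply: contrapT => yx; exact: nUy.
Qed.

(** * Translations, inversion and idempotents in inverse semigroups *)

Lemma smul_continuous_fun (T : topologicalType)
    (S : topologicalInverseSemigroupType) (f g : T -> S) :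
  continuous f -> continuous g -> continuous (fun x => (f x * g x)%g).
Proof.
move=> cf cg x.
apply: (@continuous_comp _ _ _ (fun x => (f x, g x)) (fun p => (p.1 * p.2)%g)).
  by apply: cvg_pair; [exact: cf|exact: cg].
exact: smul_continuous.
Qed.

Lemma smull_continuous (S : topologicalInverseSemigroupType) (a : S) :
  continuous (fun x => (a * x)%g).
Proof. by apply: smul_continuous_fun; [exact: cst_continuous|move=> x; exact: cvg_id]. Qed.

Lemma smulr_continuous (S : topologicalInverseSemigroupType) (a : S) :
  continuous (fun x => (x * a)%g).
Proof. by apply: smul_continuous_fun; [move=> x; exact: cvg_id|exact: cst_continuous]. Qed.

Lemma sinvK (S : inverseSemigroupType) : involutive (@sinv S).
Proof. by move=> x; apply/esym/sinv_uniq; [exact: sinv_mulK|exact: mul_sinvK]. Qed.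

Lemma sinv_idem (S : inverseSemigroupType) (e : S) : (e * e)%g = e -> sinv e = e.
Proof. by move=> ee; apply/esym/sinv_uniq; rewrite !ee. Qed.

Lemma mul_sinv_idem (S : inverseSemigroupType) (x : S) :
  (x * sinv x * (x * sinv x))%g = (x * sinv x)%g.
Proof. by rewrite mulgA mul_sinvK. Qed.

(** * Finiteness properties of [IN_g j] *)

Lemma pmulE (g h : Defs.pmap) (x : posn) : (g * h)%g x = obind h (g x).
Proof. by []. Qed.

Lemma IN_g_valM (j : nat) (g h : IN_g_type j) : val (g * h)%g = (val g * val h)%g.
Proof. by []. Qed.

(* The domain of such a [g] contains every [x >= u + j], and [g] is the
   translation by [v - u]; so [g] is determined by the trace of its domain
   below [u + j]. *)
Lemma IN_g_finite_value (j : nat) (u v : posn) :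
  finite_set [set g : IN_g_type j | val g u = Some v].
Proof.
pose rebuild (s : {set 'I_(u + j)}) : Defs.pmap := Pmap (fun x =>
  if [exists i : 'I_(u + j), (i == x :> nat) && (i \notin s)] then None
  else insub (x + v - u)%N).
suff fin : finite_set [set g | IN_g j g /\ g u = Some v].
  apply: (@sub_finite_set _ _ (val @^-1` [set g | IN_g j g /\ g u = Some v])).
    by move=> g guv; split=> //; exact: set_valP.
  by apply: finite_preimage => // x y _ _; exact: val_inj.
apply: sub_finite_set (finite_image rebuild (@finite_finset _ setT)).
move=> g [[gI gj] guv].
exists [set i : 'I_(u + j) | `[< exists2 x : posn, pdom g x & x = i :> nat >]]%SET => //.
have [c gc] := IN_infty_shift gI; have cuv := gc _ _ guv.
have [_ /(_ u (ex_intro _ _ guv)) mu] := ndom_minP gI.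
have [sh _] := ndom_shiftP gI.
apply: pmap_ext => x; rewrite /rebuild /=; case: ifPn.
  move=> /existsP[i /andP[/eqP ix]]; rewrite inE => /asboolPn nx.
  case gx: (g x) => [y|] //; exfalso; apply: nx; exists x => //.
  by exists y.
move=> /existsPn nE; have [y gx] : pdom g x.
  (* Since [ndom_min g <= u], the bound on the gap gives [ndom_shift g <= u + j]. *)
  have [xs|xs] := leqP (u + j) x; first by apply: sh; lia.
  move: (nE (Ordinal xs)); rewrite /= eqxx /= negbK inE => /asboolP[z].
  by move=> gz /val_inj <-.
have gcx := gc _ _ gx; have y0 := posn_gt0 y.
rewrite gx insubT; first by lia.
by move=> p; congr Some; apply: val_inj => /=; lia.
Qed.

Lemma IN_g_finite_below (j N : nat) : finite_set [set g : IN_g_type j |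
  exists u v : posn, [/\ u < N, v < N & val g u = Some v]%N].
Proof.
have fN : finite_set [set u : posn | u < N]%N.
  rewrite -(setCK [set u : posn | u < N]%N); apply: (@cofinite_posn _ N) => x /=.
  lia.
have fF := bigcup_finite fN (fun u _ => bigcup_finite fN (fun v _ =>
  IN_g_finite_value j u v)).
by apply: sub_finite_set fF => g [u [v [uN vN guv]]]; exists u => //; exists v.
Qed.

Definition partial_id (f : Defs.pmap) : Prop := forall x y : posn, f x = Some y -> y = x.

Lemma partial_id_mulC (f g : Defs.pmap) :
  partial_id f -> partial_id g -> (f * g = g * f)%g.
Proof.
move=> fid gid; apply: pmap_ext => x; rewrite !pmulE.
case fx: (f x) => [y|]; case gx: (g x) => [z|] //=.
- have yx := fid _ _ fx; have zx := gid _ _ gx; subst y z.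
  by rewrite fx gx.
- by rewrite (fid _ _ fx) gx.
- by rewrite (gid _ _ gx) fx.
Qed.

(** As [f] is the identity from [N] on, [f * g] can only lose points of the domain of [g] below
    [N]. *)
Lemma pmul_neql (f g : Defs.pmap) (N : nat) : partial_id f ->
  (forall x : posn, N <= x -> f x = Some x)%N -> (f * g)%g <> g ->
  exists u v : posn, (u < N)%N /\ g u = Some v.
Proof.
move=> fI fN fg; apply: contrapT => nE; apply: fg; apply: pmap_ext => x.
rewrite pmulE; have [/fN ->//|xN] := leqP N x.
case gx: (g x) => [y|]; first by case: nE; exists x, y.
by case fx: (f x) => [z|] //=; rewrite (fI _ _ fx).
Qed.

Lemma pmul_neqr (f g : Defs.pmap) (N : nat) :
  (forall x : posn, N <= x -> f x = Some x)%N -> (g * f)%g <> g ->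
  exists u v : posn, (v < N)%N /\ g u = Some v.
Proof.
move=> fN gf; apply: contrapT => nE; apply: gf; apply: pmap_ext => x.
rewrite pmulE; case gx: (g x) => [y|] //=.
by have [/fN ->//|yN] := leqP N y; case: nE; exists x, y.
Qed.

Lemma IN_g_idem (j : nat) (g : IN_g_type j) : (g * g)%g = g ->
  partial_id (val g) /\
  exists N, forall x : posn, (N <= x)%N -> val g x = Some x.
Proof.
move=> gg; have [gI _] : IN_g j (val g) by exact: set_valP.
have [c gc] := IN_infty_shift gI.
have gid : partial_id (val g).
  (* If [g] sends [x] to [y], idempotence makes it send [y] to [y], so its translation constant is
     0. *)
  move=> x y gx; have : (val g * val g)%g x = Some y by rewrite -IN_g_valM gg.
  rewrite pmulE gx /= => gy; apply: val_inj => /=.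
  have := gc _ _ gx; have := gc _ _ gy; lia.
split=> //; have [_ /cofinite_dom[N hN] _] := gI.
by exists N => x /hN[y gx]; rewrite gx (gid _ _ gx).
Qed.

(** The gap between [ndom_min] and [ndom_shift] is 0 here. These identities of [[N)] are the test
    idempotents that will isolate points. *)
Lemma IN_g_prestr1 (j : nat) (N : posn) : IN_g j (prestr 1%g N).
Proof.
have E x : prestr 1%g N x = if (N <= x)%N then Some x else None by [].
have gI : IN_infty (prestr 1%g N).
  split.
  - move=> x y x' y'; rewrite !E.
    by case: ifP => // _ [<-]; case: ifP => // _ [<-].
  - by apply: (@cofinite_posn _ N) => x Nx; exists x; rewrite E Nx.
  - by apply: (@cofinite_posn _ N) => x Nx; exists x; rewrite E Nx.
split=> //; have [[y +] _] := ndom_minP gI.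
rewrite E; case: ifP => // Nm _.
have [_ /(_ N) sh] := ndom_shiftP gI.
have : (ndom_shift (prestr 1%g N) <= N)%N.
  by apply: sh => x Nx; exists x; rewrite E Nx.
lia.
Qed.

Lemma prestr1_mul_neq (g : Defs.pmap) (u v N : posn) :
  (u < N)%N -> g u = Some v -> (prestr 1%g N * g)%g <> g.
Proof.
move=> uN gu /(congr1 (fun h : Defs.pmap => h u)); rewrite pmulE gu.
by rewrite /prestr /= leqNgt uN.
Qed.

Lemma mul_prestr1_neq (g : Defs.pmap) (u v N : posn) :
  (v < N)%N -> g u = Some v -> (g * prestr 1%g N)%g <> g.
Proof.
move=> vN gu /(congr1 (fun h : Defs.pmap => h u)); rewrite pmulE gu.
by rewrite /prestr /= leqNgt vN.
Qed.

Definition IN_g_prestr1_elt (j : nat) (N : posn) : IN_g_type j :=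
  SigSub (mem_set (IN_g_prestr1 j N)).

Lemma IN_g_finite_neq (j N : nat) (f : IN_g_type j) :
  partial_id (val f) ->
  (forall x : posn, N <= x -> val f x = Some x)%N ->
  finite_set [set g : IN_g_type j | (f * g)%g <> g /\ (g * f)%g <> g].
Proof.
move=> fid fN; apply: sub_finite_set (IN_g_finite_below j N) => g [fg gf].
have [u [v [uN guv]]] : exists u v : posn, (u < N)%N /\ val g u = Some v.
  apply: (@pmul_neql (val f)) => //.
  by move=> e; apply: fg; apply: val_inj.
have [u' [v' [vN guv']]] : exists u v : posn, (v < N)%N /\ val g u = Some v.
  apply: (@pmul_neqr (val f)) => //.
  by move=> e; apply: gf; apply: val_inj.
have [c gc] := IN_infty_shift (set_valP g).1.
have := gc _ _ guv; have := gc _ _ guv' => c1 c2.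
(* If [v >= N], then [g] translates upwards and [u' < v' < N]; otherwise [u] and [v] are both below
   [N]. *)
by have [vN'|vN'] := leqP N v; [exists u', v'|exists u, v]; split=> //; lia.
Qed.

Lemma IN_g_dom (j : nat) (g : IN_g_type j) : exists u v, val g u = Some v.
Proof. by have [[v gu] _] := ndom_minP (set_valP g).1; exists (ndom_min (val g)), v. Qed.

(** Evaluation at one point of the domain of [m] prescribes one value of [g], which leaves finitely
    many [g]. *)
Lemma IN_g_finite_divl (j : nat) (a m : IN_g_type j) :
  finite_set [set g : IN_g_type j | (a * g)%g = m].
Proof.
have [x [z mx]] := IN_g_dom m.
case ax: (val a x) => [y|]; last first.
  apply: sub_finite_set (@finite_set0 _) => g agm.
  by move: mx; rewrite -agm IN_g_valM pmulE ax.
apply: sub_finite_set (IN_g_finite_value j y z) => g agm.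
by move: mx; rewrite -agm IN_g_valM pmulE ax.
Qed.

Lemma IN_g_finite_divr (j : nat) (a m : IN_g_type j) :
  finite_set [set g : IN_g_type j | (g * a)%g = m].
Proof.
have [x [z mx]] := IN_g_dom m.
have [c ac] := IN_infty_shift (set_valP a).1.
(* A solution must send [x] to a preimage of [z] under [a], and [a], being a translation on its
   domain, has at most one. *)
have [[y ay]|nay] := pselect (exists y, val a y = Some z); last first.
  apply: sub_finite_set (@finite_set0 _) => g gam.
  move: mx; rewrite -gam IN_g_valM pmulE.
  by case gx: (val g x) => [y|] //= ay; case: nay; exists y.
apply: sub_finite_set (IN_g_finite_value j x y) => g gam.
move: mx; rewrite -gam IN_g_valM pmulE; case gx: (val g x) => [y'|] //= ay'.
rewrite /= gx; congr Some; apply: val_inj => /=.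
have := ac _ _ ay; have := ac _ _ ay'; lia.
Qed.

(** * Isolated points, and the remainder as an ideal *)

Lemma finite_setI_range (T U : Type) (phi : T -> U) (A : set U) :
  finite_set (phi @^-1` A) -> finite_set (A `&` range phi).
Proof.
move=> fU; apply: sub_finite_set (finite_image phi fU).
by move=> x [Ax [g _ gx]]; exists g; rewrite //= gx.
Qed.

Lemma IN_g_isolated (j : nat) (S : topologicalInverseSemigroupType)
    (phi : {multiplicative IN_g_type j -> S}) (g : IN_g_type j) :
  hausdorff_space S -> injective phi -> dense (range phi) ->
  open [set phi g].
Proof.
move=> hS phiI dphi; have [u [v guv]] := IN_g_dom g.
(* [N] exceeds both [u] and [v], so multiplying [g] by the identity of [[N)] on either side loses
   the pair [(u, v)]. *)
pose N := posnD u v.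
have E x : val (IN_g_prestr1_elt j N) x = if (N <= x)%N then Some x else None by [].
set f := IN_g_prestr1_elt j N in E.
have fid : partial_id (val f) by move=> x y; rewrite E; case: ifP => // _ [].
have fN (x : posn) : (N <= x)%N -> val f x = Some x by rewrite E => ->.
have u0 := posn_gt0 u; have v0 := posn_gt0 v.
pose W := [set x : S | (phi f * x)%g <> x] `&` [set x | (x * phi f)%g <> x].
apply: (@dense_open_finite_set1 _ (range phi) W).
- exact: hausdorff_accessible.
- exact: dphi.
- by apply: openI; apply: (open_neq_continuous hS);
    [exact: smull_continuous|move=> x; exact: cvg_id
    |exact: smulr_continuous|move=> x; exact: cvg_id].
- apply: finite_setI_range; apply: sub_finite_set (IN_g_finite_neq fid fN).
  by move=> h [fh hf]; split=> e; [apply: fh|apply: hf]; rewrite -gmulfM e.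
- split; rewrite /= -gmulfM => /phiI /(congr1 val).
    by apply: (prestr1_mul_neq (N := N) _ guv); rewrite /N /=; lia.
  by apply: (mul_prestr1_neq (N := N) _ guv); rewrite /N /=; lia.
Qed.

(** The fibre of [h] over the isolated point [phi m] is open and has a finite trace on the dense
    range. *)
Lemma fiber_in_range (j : nat) (S : topologicalInverseSemigroupType)
    (phi : {multiplicative IN_g_type j -> S}) (h : S -> S) (m : IN_g_type j) (y : S) :
  hausdorff_space S -> injective phi -> dense (range phi) ->
  continuous h -> finite_set [set g | h (phi g) = phi m] ->
  h y = phi m -> range phi y.
Proof.
move=> hS phiI dphi ch fin hy.
apply: (@dense_open_finite_sub _ (range phi) (h @^-1` [set phi m])) => //.
- exact: hausdorff_accessible.
- by move/continuousP: ch; apply; exact: IN_g_isolated.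
- exact: finite_setI_range.
Qed.

Lemma remainder_ideal (j : nat) (S : topologicalInverseSemigroupType)
    (phi : {multiplicative IN_g_type j -> S}) (x y : S) :
  hausdorff_space S -> injective phi -> dense (range phi) ->
  (~ range phi x \/ ~ range phi y) -> ~ range phi (x * y)%g.
Proof.
move=> hS phiI dphi.
have idl a z : range phi (phi a * z)%g -> range phi z.
  move=> [m _ /esym]; apply: (fiber_in_range hS phiI dphi (@smull_continuous _ _)).
  by apply: sub_finite_set (IN_g_finite_divl a m) => g; rewrite /= -gmulfM => /phiI.
have idr a z : range phi (z * phi a)%g -> range phi z.
  move=> [m _ /esym]; apply: (fiber_in_range hS phiI dphi (@smulr_continuous _ _)).
  by apply: sub_finite_set (IN_g_finite_divr a m) => g; rewrite /= -gmulfM => /phiI.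
move=> nxy [m _ mxy].
(* As [phi m] is isolated, density lets either factor of [x * y = phi m] be replaced by an element
   of the range; then [idl] or [idr] applies to the other factor. *)
have ex_near (h : S -> S) z : continuous h -> h z = phi m ->
    exists g, h (phi g) = phi m.
  move=> ch hz; have [||w [hw [g _ gw]]] := dphi (h @^-1` [set phi m]).
  - by exists z.
  - by move/continuousP: ch; apply; exact: IN_g_isolated.
  - by exists g; rewrite gw.
have [g gy] := ex_near _ x (@smulr_continuous _ y) (esym mxy).
have [g' xg'] := ex_near _ y (@smull_continuous _ x) (esym mxy).
case: nxy; apply; first by apply: (idr g'); rewrite xg'; exists m.
by apply: (idl g); rewrite gy; exists m.
Qed.

Lemma remainder_sinv (j : nat) (S : topologicalInverseSemigroupType)
    (phi : {multiplicative IN_g_type j -> S}) (x : S) :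
  hausdorff_space S -> injective phi -> dense (range phi) ->
  range phi (sinv x) -> range phi x.
Proof.
move=> hS phiI dphi; suff sv z : range phi z -> range phi (sinv z).
  by move=> /sv; rewrite sinvK.
move=> [g _ <-]; apply: contrapT => ng.
suff : ~ range phi (phi g * sinv (phi g) * phi g)%g by rewrite mul_sinvK; apply; exists g.
apply: remainder_ideal => //; left.
by apply: remainder_ideal => //; right.
Qed.

(** * Idempotents of the remainder *)

Lemma dense_idem (j : nat) (S : topologicalInverseSemigroupType)
    (phi : {multiplicative IN_g_type j -> S}) (e : S) (O : set S) :
  hausdorff_space S -> injective phi -> dense (range phi) ->
  (e * e)%g = e -> open O -> O e ->
  exists2 g : IN_g_type j, (g * g)%g = g & O (phi g).
Proof.
(* [p] is continuous, has only idempotent values and fixes [e], so any point of the range that [p]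
   sends into [O] yields the idempotent. *)
move=> hS phiI dphi ee oO Oe; pose p (x : S) := (x * sinv x)%g.
have cp : continuous p.
  by apply: smul_continuous_fun => x; [exact: cvg_id|exact: sinv_continuous].
have [||x [Op [g _ gx]]] := dphi (p @^-1` O); last rewrite -{}gx in Op.
- by exists e; rewrite /p /= sinv_idem // ee.
- by move/continuousP: cp; apply.
have [h _ hg] : range phi (sinv (phi g)).
  by apply: remainder_sinv => //; rewrite sinvK; exists g.
exists (g * h)%g; last by rewrite gmulfM hg.
by apply: phiI; rewrite !gmulfM hg mul_sinv_idem.
Qed.

Lemma idem_absorb (j : nat) (S : topologicalInverseSemigroupType)
    (phi : {multiplicative IN_g_type j -> S}) (e : S) (f : IN_g_type j) :
  hausdorff_space S -> injective phi -> dense (range phi) ->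
  (e * e)%g = e -> ~ range phi e -> (f * f)%g = f ->
  (phi f * e = e /\ e * phi f = e)%g.
Proof.
move=> hS phiI dphi ee ne ff; have [fid [N fN]] := IN_g_idem ff.
have absorb (h : S -> S) : continuous h ->
    (forall g : IN_g_type j, (g * g)%g = g -> h (phi g) <> phi g ->
      (f * g)%g <> g /\ (g * f)%g <> g) -> h e = e.
  move=> ch hf; apply: contrapT => he.
  (* The exceptional elements form a finite set that avoids [e]. If [h e <> e], an idempotent of the
     range close to [e] would be moved by [h] without being exceptional. *)
  have fin := finite_image phi (IN_g_finite_neq fid fN).
  have oU : open [set x | h x <> x].
    by apply: (open_neq_continuous hS) => // x; exact: cvg_id.
  have [] := dense_idem hS phiI dphi ee (open_setD_finite (hausdorff_accessible hS) oU fin).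
    by split=> // -[g _ ge]; apply: ne; exists g.
  by move=> g gg [/= hg]; apply; exists g => //; exact: hf.
(* Idempotents commute, so one that is moved by [f] on one side is moved on both. *)
have fgC g : (g * g)%g = g -> (f * g = g * f)%g.
  by move=> gg; have [gid _] := IN_g_idem gg; apply: val_inj; exact: partial_id_mulC.
split; [apply: (absorb (fun x => phi f * x)%g)|apply: (absorb (fun x => x * phi f)%g)].
- exact: smull_continuous.
- by move=> g gg; rewrite -gmulfM -(fgC _ gg) => n; split=> e'; apply: n; rewrite e'.
- exact: smulr_continuous.
- by move=> g gg; rewrite -gmulfM -(fgC _ gg) => n; split=> e'; apply: n; rewrite e'.
Qed.

Lemma remainder_idem_uniq (j : nat) (S : topologicalInverseSemigroupType)
    (phi : {multiplicative IN_g_type j -> S}) (e e' : S) :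
  hausdorff_space S -> injective phi -> dense (range phi) ->
  (e * e)%g = e -> ~ range phi e -> (e' * e')%g = e' -> ~ range phi e' -> e = e'.
Proof.
move=> hS phiI dphi ee ne ee' ne'.
have absorb (h : S -> S) d c : continuous h -> (d * d)%g = d ->
    (forall f : IN_g_type j, (f * f)%g = f -> h (phi f) = c) -> h d = c.
  move=> ch dd hf; apply: contrapT => hd.
  have oU : open [set x | h x <> c].
    by apply: (open_neq_continuous hS) => //; exact: cst_continuous.
  by have [f ff /(_ (hf _ ff))] := dense_idem hS phiI dphi dd oU hd.
(* Idempotents of the range absorb into [e] and into [e']; passing to the limit [e'] in the first
   factor gives [e' * e = e], and to the limit [e] in the second gives [e' * e = e']. *)
transitivity (e' * e)%g.
  apply/esym; apply: (absorb (fun x => x * e)%g) => //.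
    exact: smulr_continuous.
  by move=> f ff; have [] := idem_absorb hS phiI dphi ee ne ff.
apply: (absorb (fun x => e' * x)%g) => //.
  exact: smull_continuous.
by move=> f ff; have [] := idem_absorb hS phiI dphi ee' ne' ff.
Qed.

(** * The group structure on the remainder *)

Theorem theorem3p6 (j : nat) (S : topologicalInverseSemigroupType)
    (phi : {multiplicative IN_g_type j -> S}) :
  (0 < j)%N ->
  hausdorff_space S ->
  injective phi ->
  dense (range phi) ->
  range phi `<` [set: S] ->
  induces_topological_group (~` range phi).
Proof.
move=> _ hS phiI dphi [_ nsub].
pose G := set_type (~` range phi).
have GP (x : G) : ~ range phi (val x) by exact: (set_valP x).
have [x0 nx0] : exists x, ~ range phi x.
  by apply: contrapT => /forallNP h; apply: nsub => x _; exact: (contrapT (h x)).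
have mulP (x y : S) : ~ range phi x -> ~ range phi (x * y)%g.
  by move=> nx; apply: remainder_ideal => //; left.
have invP (x : S) : ~ range phi x -> ~ range phi (sinv x).
  by move=> nx /(remainder_sinv hS phiI dphi).
pose mk (x : S) (nx : ~ range phi x) : G := SigSub (@mem_set _ (~` range phi) x nx).
pose op (x y : G) : G := mk _ (mulP (val x) (val y) (GP x)).
pose inv (x : G) : G := mk _ (invP (val x) (GP x)).
pose e : G := op (mk _ nx0) (inv (mk _ nx0)).
have ee : (val e * val e)%g = val e by exact: (mul_sinv_idem x0).
(* Both sides are idempotents of the remainder, which has only one. *)
have mulV (x : S) : ~ range phi x -> (x * sinv x)%g = val e.
  move=> nx; exact: (remainder_idem_uniq hS phiI dphi (mul_sinv_idem x)
    (mulP x (sinv x) nx) ee (GP e)).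
have Vmul (x : S) : ~ range phi x -> (sinv x * x)%g = val e.
  by move=> nx; rewrite -[x in (_ * x)%g]sinvK mulV //; exact: (invP x nx).
exists op; split=> //; exists e, inv; split.
- by move=> x y z; apply: val_inj; rewrite /= mulgA.
- split=> x; apply: val_inj.
  + suff : (val e * val x)%g = val x by [].
    by rewrite -(mulV _ (GP x)) mul_sinvK.
  + suff : (val x * val e)%g = val x by [].
    by rewrite -(Vmul _ (GP x)) mulgA mul_sinvK.
- by split=> x; apply: val_inj; [exact: (Vmul _ (GP x))|exact: (mulV _ (GP x))].
(* The subspace topology is initial for [set_val], so continuity is checked in [S]. *)
- apply: continuous_comp_initial.
  apply: (@smul_continuous_fun _ S (set_val \o fst) (set_val \o snd)) => p.
  + by apply: continuous_comp; [exact: cvg_fst|exact: initial_continuous].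
  + by apply: continuous_comp; [exact: cvg_snd|exact: initial_continuous].
- apply: continuous_comp_initial.
  change (continuous (sinv \o (set_val : G -> S))) => x.
  by apply: continuous_comp; [exact: initial_continuous|exact: sinv_continuous].
Qed.
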